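(* Let $Q$ be a convex quadrilateral. (i) If $Q$ is a midpoint diagonal quadrilateral, then each ellipse inscribed in $Q$ has a unique pair of conjugate diameters parallel to the diagonals of $Q$ (one diameter of the pair parallel to one diagonal, the other diameter parallel to the other diagonal). (ii) If $Q$ is not a midpoint diagonal quadrilateral, then no ellipse inscribed in $Q$ has a pair of conjugate diameters parallel to the diagonals of $Q$.
   Context: An ellipse (circles included) is inscribed in a convex quadrilateral $Q$ if it lies inside $Q$ and is tangent to each side of $Q$. A convex quadrilateral $Q$ is a midpoint diagonal quadrilateral if the intersection point of its diagonals coincides with the midpoint of at least one of the diagonals. A diameter of an ellipse is a chord through its center. Given a diameter $l$ of an ellipse $E_0$, there is a unique diameter $m$ of $E_0$ such that the midpoints of all chords of $E_0$ parallel to $l$ lie on $m$; then $l$ and $m$ are called conjugate diameters of $E_0$. Two lines are called parallel also when they are equal; segments are parallel if the lines containing them are. *)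

(* Defs.v *)
From mathcomp Require Import all_boot all_order all_algebra.
From mathcomp Require Import boolp classical_sets reals.

Set Implicit Arguments.
Unset Strict Implicit.
Unset Printing Implicit Defensive.

Import Order.TTheory GRing.Theory Num.Theory.

Local Open Scope classical_set_scope.
Local Open Scope ring_scope.

Definition plane (R : realType) := 'rV[R]_2.

Definition dot (R : realType) (u v : plane R) : R := (u *m v^T) 0 0.

Definition orient (R : realType) (A B C : plane R) : R :=
  \det (col_mx (B - A) (C - A) : 'M[R]_2).

Definition midpoint (R : realType) (A B : plane R) : plane R :=
  2^-1 *: (A + B).

Definition line (R : realType) (A B : plane R) : set (plane R) :=
  [set P | exists t : R, P = (1 - t) *: A + t *: B].

Definition segment (R : realType) (A B : plane R) : set (plane R) :=
  [set P | exists2 t : R, 0 <= t <= 1 & P = (1 - t) *: A + t *: B].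

Definition is_line (R : realType) (L : set (plane R)) : Prop :=
  exists A B : plane R, A <> B /\ L = line A B.

Definition parallel_lines (R : realType) (L M : set (plane R)) : Prop :=
  L = M \/ L `&` M = set0.

(* Meant for nondegenerate segments, each of which lies on exactly one line. *)
Definition parallel (R : realType) (s t : set (plane R)) : Prop :=
  exists L M : set (plane R),
    [/\ is_line L, is_line M, s `<=` L, t `<=` M & parallel_lines L M].

(* The vertices are listed in cyclic order.  For each of the four sides, the
   two other vertices lie strictly on the same side of the line through it;
   in particular no three vertices are collinear. *)
Definition convex_quadrilateral (R : realType) (A B C D : plane R) : Prop :=
  [/\ 0 < orient A B C * orient A B D,
      0 < orient B C D * orient B C A,
      0 < orient C D A * orient C D B &
      0 < orient D A B * orient D A C].

(* The closed region bounded by the convex quadrilateral ABCD, as the convex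
   hull of its vertices. *)
Definition quad_region (R : realType) (A B C D : plane R) : set (plane R) :=
  [set P | exists a b c d : R,
    [/\ 0 <= a, 0 <= b, 0 <= c & 0 <= d] /\
    a + b + c + d = 1 /\ P = a *: A + b *: B + c *: C + d *: D].

Definition midpoint_diagonal (R : realType) (A B C D : plane R) : Prop :=
  exists P : plane R,
    segment A C `&` segment B D = [set P] /\
    (P = midpoint A C \/ P = midpoint B D).

(* An ellipse in canonical position x^2/a^2 + y^2/b^2 = 1 with respect to an
   orthonormal frame (center; axis1, axis2).  Circles are the case a = b. *)
Record ellipse (R : realType) := Ellipse {
  center : plane R;
  axis1 : plane R;
  axis2 : plane R;
  semi1 : R;
  semi2 : R;
  axis1_unit : dot axis1 axis1 = 1;
  axis2_unit : dot axis2 axis2 = 1;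
  axis_orthogonal : dot axis1 axis2 = 0;
  semi1_gt0 : 0 < semi1;
  semi2_gt0 : 0 < semi2 }.

(* The curve itself, not the region it encloses. *)
Definition ellipse_curve (R : realType) (E : ellipse R) : set (plane R) :=
  [set P | (dot (P - center E) (axis1 E) / semi1 E) ^+ 2 +
           (dot (P - center E) (axis2 E) / semi2 E) ^+ 2 = 1].

(* The line through the side meets the ellipse in exactly one point, and this
   point belongs to the side. *)
Definition tangent_to_side (R : realType) (E : ellipse R) (A B : plane R) :
    Prop :=
  exists2 T : plane R,
    segment A B T & line A B `&` ellipse_curve E = [set T].

Definition inscribed (R : realType) (E : ellipse R) (A B C D : plane R) :
    Prop :=
  ellipse_curve E `<=` quad_region A B C D /\
  [/\ tangent_to_side E A B, tangent_to_side E B C,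
      tangent_to_side E C D & tangent_to_side E D A].

Definition chord_between (R : realType) (E : ellipse R) (X Y : plane R) :
    Prop :=
  [/\ ellipse_curve E X, ellipse_curve E Y & X <> Y].

Definition diameter (R : realType) (E : ellipse R) (s : set (plane R)) : Prop :=
  exists X Y : plane R,
    [/\ chord_between E X Y, s = segment X Y & s (center E)].

Definition conjugate_diameters (R : realType) (E : ellipse R)
    (l m : set (plane R)) : Prop :=
  [/\ diameter E l, diameter E m &
      forall X Y : plane R, chord_between E X Y ->
        parallel (segment X Y) l -> m (midpoint X Y)].

(* A pair of diameters is an unordered pair, represented by the two-element set
   [set l; m] of the two segments. *)
Definition conjugate_pair (R : realType) (E : ellipse R)
    (p : set (set (plane R))) : Prop :=
  exists l m : set (plane R), p = [set l; m] /\ conjugate_diameters E l m.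

Definition pair_parallel_to_diagonals (R : realType) (A B C D : plane R)
    (p : set (set (plane R))) : Prop :=
  exists l m : set (plane R),
    [/\ p = [set l; m], parallel l (segment A C) & parallel m (segment B D)].

(* Main.v *)
(* Use the inner product that makes the ellipse a unit circle; conjugate
   diameters become perpendicular ones, so both parts reduce to: in a quadrilateral
   circumscribed about a circle, the diagonals are perpendicular iff one of
   them bisects the other.  Let a, b, c, d be the tangent lengths at A, B, C, D.
   The sides being a + b, b + c, c + d, d + a, the diagonals are perpendicular
   iff (a + b)^2 + (c + d)^2 = (b + c)^2 + (d + a)^2, that is,
   (a - c)(b - d) = 0.  If a = c, then B and D are equidistant from A and C, so
   BD passes through the midpoint of AC.  Conversely, if the midpoint of AC is
   (1 - t) B + t D with 0 <= t <= 1, then AB^2 - BC^2 and AD^2 - CD^2 are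
   -2t K and 2(1 - t) K, where K is the inner product of the diagonals, and
   both have the sign of a - c; hence a = c and K = 0. *)
Require Import Defs.
From mathcomp Require Import all_boot all_order all_algebra.
From mathcomp Require Import boolp classical_sets reals.
From mathcomp Require Import ring lra.

Import Order.TTheory GRing.Theory Num.Theory.

Local Open Scope classical_set_scope.
Local Open Scope ring_scope.

(** * Coordinates, determinants and Cramer's rule in the plane *)

Lemma plane_eqP {R : realType} (u v : plane R) :
  u 0 0 = v 0 0 -> u 0 1 = v 0 1 -> u = v.
Proof.
move=> h0 h1; apply/rowP => j.
by case: (splitP (j : 'I_(1 + 1))) => k; rewrite ord1 => hk;
  [have -> : j = 0 by apply/val_inj | have -> : j = 1 by apply/val_inj].
Qed.

Definition cross {R : realType} (u v : plane R) : R :=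
  u 0 0 * v 0 1 - u 0 1 * v 0 0.

Lemma orientE {R : realType} (A B C : plane R) :
  orient A B C = cross (B - A) (C - A).
Proof.
rewrite /orient (expand_det_row _ 0) big_ord_recl big_ord1 /cofactor !det_mx11 !mxE /=.
have s0 : split (0 : 'I_(1 + 1)) = inl (0 : 'I_1).
  by case: splitP => // k _; rewrite ord1.
have s1 : split (lift 0 0 : 'I_(1 + 1)) = inr (0 : 'I_1).
  by case: splitP => k; rewrite ord1.
have e1 : lift ord0 0 = 1 :> 'I_2 by apply/val_inj.
have e2 : lift (lift ord0 ord0) 0 = 0 :> 'I_2 by apply/val_inj.
rewrite s0 s1 e2 !e1 /cross !mxE /= /bump /=; ring.
Qed.

Lemma dotE {R : realType} (u v : plane R) :
  dot u v = u 0 0 * v 0 0 + u 0 1 * v 0 1.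
Proof.
rewrite /dot mxE big_ord_recl big_ord1 !mxE.
by have -> : lift ord0 ord0 = 1 :> 'I_2 by apply/val_inj.
Qed.

Lemma crossC {R : realType} (u v : plane R) : cross u v = - cross v u.
Proof. rewrite /cross; ring. Qed.

Lemma crossZr {R : realType} k (u v : plane R) :
  cross u (k *: v) = k * cross u v.
Proof. rewrite /cross !mxE; ring. Qed.

Lemma cross_self {R : realType} (u : plane R) : cross u u = 0.
Proof. rewrite /cross; ring. Qed.

(** Cramer's rule with the denominator cleared, so that it also holds for dependent [u] and [v]. *)
Lemma cramer {R : realType} (u v w : plane R) :
  cross u v *: w = cross w v *: u + cross u w *: v.
Proof. by apply: plane_eqP; rewrite /cross !mxE; ring. Qed.

Lemma cross_eq0P {R : realType} (u v : plane R) :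
  u != 0 -> cross u v = 0 -> exists k, v = k *: u.
Proof.
move=> u0 uv0.
(* [w] is [u] turned by a right angle; it completes [u] to a basis, in which Cramer's rule expresses
   [v]. *)
pose w : plane R := \row_j (if j == 0 then - u 0 1 else u 0 0).
have uwE : cross u w = u 0 0 ^+ 2 + u 0 1 ^+ 2.
  by rewrite /cross !mxE /=; ring.
have uw0 : cross u w != 0.
  apply: contra u0; rewrite uwE paddr_eq0 ?sqr_ge0 // !sqrf_eq0.
  by case/andP=> /eqP h0 /eqP h1; apply/eqP/plane_eqP; rewrite !mxE.
exists ((cross u w)^-1 * cross v w).
have := cramer u w v; rewrite uv0 scale0r addr0 => e.
by rewrite -scalerA -e scalerK.
Qed.

(** * Segments, lines and parallelism *)

Lemma segment_line {R : realType} {X Y : plane R} : segment X Y `<=` line X Y.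
Proof. by move=> P [t _ ->]; exists t. Qed.

Lemma segment_l {R : realType} (X Y : plane R) : segment X Y X.
Proof. by exists 0; rewrite ?lexx ?ler01 // subr0 scale1r scale0r addr0. Qed.

Lemma segmentC {R : realType} (X Y : plane R) : segment X Y = segment Y X.
Proof.
suff h : forall U V : plane R, segment U V `<=` segment V U by apply/seteqP; split; exact: h.
move=> U V P [t ht ->]; exists (1 - t); first lra.
by rewrite subKr addrC.
Qed.

Lemma segment_r {R : realType} (X Y : plane R) : segment X Y Y.
Proof. by rewrite segmentC; exact: segment_l. Qed.

Lemma line_dir {R : realType} {A B P Q : plane R} :
  line A B P -> line A B Q -> exists k, Q - P = k *: (B - A).
Proof.
move=> [s ->] [t ->]; exists (t - s).
by apply: plane_eqP; rewrite !mxE; ring.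
Qed.

(** Lines with independent directions are distinct and meet in the point given by Cramer's rule.
    Lines with proportional directions and a common point coincide, by an affine change of
    parameter. *)
Lemma parallel_segments {R : realType} (X Y Z W : plane R) :
  X <> Y -> Z <> W ->
  parallel (segment X Y) (segment Z W) <-> cross (Y - X) (W - Z) = 0.
Proof.
move=> XY ZW; split=> [[L [M [[A [B [AB ->]]] [A' [B' [AB' ->]]] sL sM LM]]]|].
  have [k hk] := line_dir (sL _ (segment_l X Y)) (sL _ (segment_r X Y)).
  have [l hl] := line_dir (sM _ (segment_l Z W)) (sM _ (segment_r Z W)).
  suff h : cross (B - A) (B' - A') = 0.
    by rewrite hk hl crossZr crossC crossZr crossC h; ring.
  case: LM => [LM|LM].
    have hA : line A B A' by rewrite LM; apply/segment_line/segment_l.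
    have hB : line A B B' by rewrite LM; apply/segment_line/segment_r.
    by have [m ->] := line_dir hA hB; rewrite crossZr cross_self mulr0.
  have [//|c0] := eqVneq (cross (B - A) (B' - A')) 0.
  (* [t] and [- s] are the coordinates of [A' - A] in the basis [B - A], [B' - A']; hence parameter
     [t] on the first line and [s] on the second give the same point. *)
  pose t := cross (A' - A) (B' - A') / cross (B - A) (B' - A').
  pose s := - (cross (B - A) (A' - A) / cross (B - A) (B' - A')).
  have E : A' - A = t *: (B - A) - s *: (B' - A').
    rewrite /t /s scaleNr opprK ![_ / _]mulrC -!scalerA -scalerDr -cramer.
    by rewrite scalerK.
  have : (line A B `&` line A' B') ((1 - t) *: A + t *: B).
    split; first by exists t.
    exists s; have -> : A' = A + (A' - A) by rewrite addrC subrK.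
    move: E => /(congr1 (fun u : plane R => (u 0 0, u 0 1))) [].
    rewrite !mxE => E0 E1.
    by apply: plane_eqP; rewrite !mxE; lra.
  by rewrite LM.
move=> h.
have YX0 : Y - X != 0 by rewrite subr_eq0; apply/eqP => /esym.
have WZ0 : W - Z != 0 by rewrite subr_eq0; apply/eqP => /esym.
have [k hk] := cross_eq0P _ _ YX0 h.
have k0 : k != 0 by apply: contra WZ0; rewrite hk => /eqP ->; rewrite scale0r.
exists (line X Y), (line Z W); split; try exact: segment_line.
- by exists X, Y.
- by exists Z, W.
have lineE (U V P : plane R) : line U V P <-> exists t, P = U + t *: (V - U).
  by split=> -[t ->]; exists t; apply: plane_eqP; rewrite !mxE; ring.
rewrite /parallel_lines.
have [e|/eqP ne] := pselect (line X Y `&` line Z W = set0); first by right.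
left.
move: ne => /set0P [P [/lineE [s hs] /lineE [t ht]]].
have hZ : Z = X + s *: (Y - X) - t *: (k *: (Y - X)).
  by rewrite -hk -hs ht addrK.
apply/seteqP; split=> T /lineE [r ->]; apply/lineE; rewrite hk hZ.
  exists ((r - s) / k + t).
  by rewrite !scalerDl !scalerA; apply: plane_eqP; rewrite !mxE; field.
exists (s - t * k + r * k).
by apply: plane_eqP; rewrite !mxE; ring.
Qed.

(** * The inner product attached to an ellipse *)

Section EllipseForm.
Context {R : realType} (E : ellipse R).

Definition coord1 (u : plane R) : R := dot u (axis1 E) / semi1 E.
Definition coord2 (u : plane R) : R := dot u (axis2 E) / semi2 E.

(* The inner product for which the ellipse is the unit circle about its
   center. *)
Definition ip (u v : plane R) : R := coord1 u * coord1 v + coord2 u * coord2 v.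

Lemma coord1D u v : coord1 (u + v) = coord1 u + coord1 v.
Proof. rewrite /coord1 !dotE !mxE; ring. Qed.
Lemma coord2D u v : coord2 (u + v) = coord2 u + coord2 v.
Proof. rewrite /coord2 !dotE !mxE; ring. Qed.
Lemma coord1Z k u : coord1 (k *: u) = k * coord1 u.
Proof. rewrite /coord1 !dotE !mxE; ring. Qed.
Lemma coord2Z k u : coord2 (k *: u) = k * coord2 u.
Proof. rewrite /coord2 !dotE !mxE; ring. Qed.
Lemma coord1N u : coord1 (- u) = - coord1 u.
Proof. by rewrite -scaleN1r coord1Z mulN1r. Qed.
Lemma coord2N u : coord2 (- u) = - coord2 u.
Proof. by rewrite -scaleN1r coord2Z mulN1r. Qed.

Definition coordE := (coord1D, coord2D, coord1Z, coord2Z, coord1N, coord2N).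

Lemma ipC u v : ip u v = ip v u.
Proof. rewrite /ip; ring. Qed.

Lemma ipZl k u v : ip (k *: u) v = k * ip u v.
Proof. rewrite /ip !coordE; ring. Qed.

Lemma ipDl u v w : ip (u + v) w = ip u w + ip v w.
Proof. rewrite /ip !coordE; ring. Qed.

Lemma ip_ge0 u : 0 <= ip u u.
Proof. by rewrite /ip -!expr2 addr_ge0 ?sqr_ge0. Qed.

Lemma ip_eq0 u : ip u u = 0 -> u = 0.
Proof.
move/eqP; rewrite /ip -!expr2 paddr_eq0 ?sqr_ge0 // !sqrf_eq0 /coord1 /coord2.
rewrite !mulf_eq0 !invr_eq0 (gt_eqF (semi1_gt0 E)) (gt_eqF (semi2_gt0 E)) !orbF.
move=> /andP[/eqP u1 /eqP u2]; apply/eqP/negPn/negP => u0.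
(* [axis1] and [axis2] cannot both be orthogonal to [u <> 0], being
   independent. *)
have := cramer (axis1 E) (axis2 E) u.
have h1 := axis1_unit E; have h2 := axis2_unit E; have h3 := axis_orthogonal E.
(* By Lagrange's identity the squared determinant is the Gram determinant, which is 1 for an
   orthonormal pair. *)
have c1 : cross (axis1 E) (axis2 E) ^+ 2 = 1.
  have <- : dot (axis1 E) (axis1 E) * dot (axis2 E) (axis2 E)
            - dot (axis1 E) (axis2 E) ^+ 2 = 1 by rewrite h1 h2 h3; ring.
  rewrite /cross !dotE; ring.
have c0 : cross (axis1 E) (axis2 E) != 0.
  by rewrite -sqrf_eq0 c1 oner_eq0.
move=> /(congr1 (dot u)).
have -> : dot u (cross u (axis2 E) *: axis1 E + cross (axis1 E) u *: axis2 E)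
  = cross u (axis2 E) * dot u (axis1 E) + cross (axis1 E) u * dot u (axis2 E).
  rewrite !dotE !mxE; ring.
rewrite u1 u2 !mulr0 addr0.
have -> : dot u (cross (axis1 E) (axis2 E) *: u)
  = cross (axis1 E) (axis2 E) * (u 0 0 ^+ 2 + u 0 1 ^+ 2).
  rewrite !dotE !mxE; ring.
move/eqP; rewrite mulf_eq0 (negbTE c0) /= paddr_eq0 ?sqr_ge0 // !sqrf_eq0.
move=> /andP[/eqP x0 /eqP y0]; move/eqP: u0; apply.
by apply: plane_eqP; rewrite !mxE.
Qed.

Lemma ip_gt0 u : u != 0 -> 0 < ip u u.
Proof.
move=> u0; rewrite lt_def ip_ge0 andbT.
by apply: contra u0 => /eqP /ip_eq0 ->.
Qed.

Lemma ip_unit_neq0 u : ip u u = 1 -> u != 0.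
Proof.
move=> u1; apply/eqP => u0; move: u1; rewrite u0 -(scale0r 0) ipZl mul0r.
by move/esym/eqP; rewrite oner_eq0.
Qed.

(** The witness is [u] turned by a right angle in the coordinates [coord1], [coord2]; the semi-axes
    enter because those coordinates divide by them. *)
Lemma ip_rot u : exists2 v, ip u v = 0 & ip v v = ip u u.
Proof.
exists (- coord2 u * semi1 E *: axis1 E + coord1 u * semi2 E *: axis2 E).
  all: have h1 := axis1_unit E; have h2 := axis2_unit E.
  all: have h3 := axis_orthogonal E.
  all: have h4 : dot (axis2 E) (axis1 E) = 0 by rewrite -h3 !dotE; ring.
  all: have a0 := gt_eqF (semi1_gt0 E); have b0 := gt_eqF (semi2_gt0 E).
  all: have e1 : coord1 (axis1 E) = (semi1 E)^-1 by rewrite /coord1 h1 mul1r.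
  all: have e2 : coord2 (axis2 E) = (semi2 E)^-1 by rewrite /coord2 h2 mul1r.
  all: have e3 : coord2 (axis1 E) = 0 by rewrite /coord2 h3 mul0r.
  all: have e4 : coord1 (axis2 E) = 0 by rewrite /coord1 h4 mul0r.
  all: rewrite /ip !coordE e1 e2 e3 e4; field; by rewrite a0 b0.
Qed.

(** Cramer's rule writes [cross v w *: u] as a combination of [v] and [w], so this multiple of [u]
    is orthogonal to [u]. *)
Lemma ip_orth_cross u v w : u != 0 -> ip v u = 0 -> ip w u = 0 -> cross v w = 0.
Proof.
move=> /ip_gt0 u0 vu wu.
have : ip (cross v w *: u) u = 0 by rewrite cramer ipDl !ipZl vu wu; ring.
by move/eqP; rewrite ipZl mulf_eq0 (gt_eqF u0) orbF => /eqP.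
Qed.

Lemma ellipse_curveE P :
  ellipse_curve E P <-> ip (P - center E) (P - center E) = 1.
Proof. by rewrite /ellipse_curve /= /ip -!expr2. Qed.

(** * Diameters and conjugacy *)

Definition diam (x : plane R) := segment (center E + x) (center E - x).

Lemma chord_sub (u v : plane R) : center E + u - (center E + v) = u - v.
Proof. by rewrite opprD addrACA subrr add0r. Qed.

(** If the center divides a chord with unit radius vectors [x], [y], then [(1 - t) x = - t y].
    Comparing norms gives [(1 - t)^2 = t^2], so [t = 1/2] and [y = - x]. *)
Lemma diamP s : diameter E s <-> exists2 x, ip x x = 1 & s = diam x.
Proof.
split=> [[X [Y [[/ellipse_curveE hX /ellipse_curveE hY XY] ->]]]|[x x1 ->]].
  move=> [t ht hc].
  set x := X - center E; set y := Y - center E.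
  have e : (1 - t) *: x = - t *: y.
    move: hc => /(congr1 (fun u : plane R => (u 0 0, u 0 1))) [].
    by rewrite !mxE => c0 c1; apply: plane_eqP; rewrite !mxE; lra.
  have : ip ((1 - t) *: x) ((1 - t) *: x) = ip (- t *: y) (- t *: y).
    by rewrite e.
  rewrite !ipZl ![ip _ (_ *: _)]ipC !ipZl hX hY => e2.
  have t2 : t = 2^-1 by lra.
  have yE : y = - x.
    move: e => /(congr1 (fun u : plane R => (u 0 0, u 0 1))) [].
    by rewrite t2 !mxE => c0 c1; apply: plane_eqP; rewrite !mxE; lra.
  exists x => //; rewrite /diam -yE; congr segment; by rewrite addrC subrK.
exists (center E + x), (center E - x); split=> //.
  split; first by apply/ellipse_curveE; rewrite addrAC subrr add0r.
    by apply/ellipse_curveE; rewrite addrAC subrr add0r -scaleN1r ipZl ipC ipZl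
      x1; ring.
  move=> /addrI e; have := ip_unit_neq0 _ x1; move/eqP; apply.
  move: e => /(congr1 (fun u : plane R => (u 0 0, u 0 1))) [].
  by rewrite !mxE => c0 c1; apply: plane_eqP; rewrite !mxE; lra.
exists 2^-1; first by lra.
by apply: plane_eqP; rewrite !mxE; field.
Qed.

Lemma diam_neq x : x != 0 -> center E + x <> center E - x.
Proof.
move=> /eqP x0 /addrI e; apply: x0.
move: e => /(congr1 (fun u : plane R => (u 0 0, u 0 1))) [].
by rewrite !mxE => c0 c1; apply: plane_eqP; rewrite !mxE; lra.
Qed.

Lemma diam_parallel x Z W : x != 0 -> Z <> W ->
  parallel (diam x) (segment Z W) <-> cross x (W - Z) = 0.
Proof.
move=> x0 ZW; have -> : cross x (W - Z) = 0 <-> cross (-2 *: x) (W - Z) = 0.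
  rewrite crossC [cross (_ *: _) _]crossC crossZr; split=> h; lra.
rewrite /diam (parallel_segments _ _ _ _ (diam_neq _ x0) ZW) chord_sub.
suff -> : - x - x = -2 *: x by [].
by apply: plane_eqP; rewrite !mxE; ring.
Qed.

Lemma parallel_diam x X Y : x != 0 -> X <> Y ->
  parallel (segment X Y) (diam x) <-> cross x (Y - X) = 0.
Proof.
move=> x0 XY; have -> : cross x (Y - X) = 0 <-> cross (Y - X) (-2 *: x) = 0.
  rewrite crossC crossZr; split=> h; lra.
rewrite /diam (parallel_segments _ _ _ _ XY (diam_neq _ x0)) chord_sub.
suff -> : - x - x = -2 *: x by [].
by apply: plane_eqP; rewrite !mxE; ring.
Qed.

Lemma mem_diam x v : diam x (center E + v) <-> exists2 k, -1 <= k <= 1 & v = k *: x.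
Proof.
split=> [[t ht e]|[k hk ->]].
  exists (1 - 2 * t); first lra.
  move: e => /(congr1 (fun u : plane R => (u 0 0, u 0 1))) [].
  by rewrite !mxE => c0 c1; apply: plane_eqP; rewrite !mxE; lra.
exists ((1 - k) / 2); first lra.
by apply: plane_eqP; rewrite !mxE; field.
Qed.

(** The source of uniqueness: collinear unit vectors differ by a sign, and the sign only swaps the
    ends of the diameter. *)
Lemma unit_collinear x y : ip x x = 1 -> ip y y = 1 -> cross x y = 0 ->
  diam x = diam y.
Proof.
move=> x1 y1 /(cross_eq0P _ _ (ip_unit_neq0 _ x1)) [k yE].
move: y1; rewrite yE ipZl ipC ipZl x1 mulr1 -expr2 => /eqP; rewrite sqrf_eq1.
case/orP=> /eqP ->; first by rewrite scale1r.
by rewrite scaleN1r /diam opprK segmentC.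
Qed.

(** As in a circle, the radius vector of the midpoint of a chord is orthogonal to the chord, so it
    lies along [y] when [y] is orthogonal to [x]. Conversely, one chord parallel to [x] and off the
    center determines the direction of [y]. *)
Lemma conjugate_diam x y : ip x x = 1 -> ip y y = 1 ->
  conjugate_diameters E (diam x) (diam y) <-> ip x y = 0.
Proof.
move=> x1 y1; have x0 := ip_unit_neq0 _ x1; have y0 := ip_unit_neq0 _ y1.
split=> [[_ _ h]|xy0].
  have [z xz zz] := ip_rot x; rewrite x1 in zz.
  (* The triple 3, 4, 5 gives a chord with ends [v + u] and [v - u] (from the center), parallel to
     [x], whose midpoint [v] is nonzero and orthogonal to [x]. *)
  pose u := (3 / 5) *: x; pose v := (4 / 5) *: z.
  have hc (e : R) : e ^+ 2 = 1 -> ellipse_curve E (center E + (e *: u + v)).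
    move=> e1; apply/ellipse_curveE; rewrite addrAC subrr add0r.
    rewrite ipDl !ipZl ![ip _ (_ + _)]ipC !ipDl !ipZl [ip z x]ipC xz x1 zz.
    have -> : e * (3 / 5 * (e * (3 / 5 * 1) + 4 / 5 * 0)) +
       4 / 5 * (e * (3 / 5 * 0) + 4 / 5 * 1) = e ^+ 2 * 9 / 25 + 16 / 25 by field.
    by rewrite e1; field.
  have dE : center E + (-1 *: u + v) - (center E + (1 *: u + v)) = - (6 / 5) *: x.
    by rewrite chord_sub; apply: plane_eqP; rewrite !mxE; field.
  have hne : center E + (1 *: u + v) <> center E + (-1 *: u + v).
    move=> e; move/eqP: dE; rewrite e subrr eq_sym scaler_eq0 (negbTE x0) orbF.
    by move/eqP => ?; lra.
  have := h (center E + (1 *: u + v)) (center E + (-1 *: u + v)).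
  case.
  - by split=> //; apply: hc; ring.
  - by apply/parallel_diam => //; rewrite dE crossZr cross_self mulr0.
  move=> t ht hm.
  have vE : v = (1 - 2 * t) *: y.
    move: hm => /(congr1 (fun w : plane R => (w 0 0, w 0 1))) [].
    by rewrite !mxE => c0 c1; apply: plane_eqP; rewrite !mxE; lra.
  have : ip v x = (1 - 2 * t) * ip y x by rewrite vE ipZl.
  rewrite ipZl [ip z x]ipC xz mulr0 [ip y x]ipC => /esym/eqP.
  (* A vanishing factor [1 - 2 * t] would put the midpoint of the chord at the center. *)
  rewrite mulf_eq0 => /orP[/eqP t0|/eqP //].
  have : ip v v = 16 / 25 by rewrite ipZl ipC ipZl zz; field.
  by rewrite vE t0 ipZl mul0r => ?; lra.
split; [by apply/diamP; exists x|by apply/diamP; exists y|].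
move=> X Y [/ellipse_curveE hX /ellipse_curveE hY XY].
move=> /(parallel_diam _ _ _ x0 XY) /(cross_eq0P _ _ x0) [k hk].
set p := X - center E in hX; set q := Y - center E in hY.
have k0 : k != 0.
  apply/eqP => k0; apply: XY; apply/esym/eqP; rewrite -subr_eq0 hk k0.
  by rewrite scale0r.
have qp : q - p = k *: x by rewrite -hk /q /p opprB addrA subrK.
pose n := 2^-1 *: (p + q).
have -> : midpoint X Y = center E + n.
  by rewrite /midpoint /n /p /q; apply: plane_eqP; rewrite !mxE; field.
have nx : ip n x = 0.
  have : ip (p + q) (q - p) = 0.
    have -> : ip (p + q) (q - p) = ip q q - ip p p by rewrite /ip !coordE; ring.
    by rewrite hX hY subrr.
  rewrite qp ipC ipZl => /eqP; rewrite mulf_eq0 (negbTE k0) /= => /eqP e.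
  by rewrite /n ipZl ipC e mulr0.
have [m nE] := cross_eq0P _ _ y0 (ip_orth_cross _ _ _ x0 (etrans (ipC _ _) xy0) nx).
apply/mem_diam; exists m => //.
(* Pythagoras for the distance [m] of the chord from the center and its half-length; it bounds [m],
   so the midpoint is on the diameter itself and not only on its line. *)
have m2 : m ^+ 2 + k ^+ 2 / 4 = 1.
  have -> : m ^+ 2 = ip n n by rewrite nE ipZl ipC ipZl y1; ring.
  have -> : k ^+ 2 = ip (q - p) (q - p) by rewrite qp ipZl ipC ipZl x1; ring.
  have -> : ip n n + ip (q - p) (q - p) / 4 = (ip p p + ip q q) / 2.
    by rewrite /n /ip !coordE; field.
  by rewrite hX hY; field.
have k2 := sqr_ge0 k.
by rewrite -ler_norml -(expr_le1 (n := 2)) // real_normK ?num_real //; lra.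
Qed.

(** * Tangent lengths *)

(** By Pythagoras, the length of a tangent from [P] to the unit circle; the square root defaults to
    0 for [P] inside. *)
Definition tlen (P : plane R) : R :=
  Num.sqrt (ip (P - center E) (P - center E) - 1).

(* The two tangent lengths at the ends of a side add up to the side because
   the point of tangency lies between the ends. *)
Lemma tangent_side_length A B : A <> B -> tangent_to_side E A B ->
  ip (B - A) (B - A) = (tlen A + tlen B) ^+ 2 /\ 0 < tlen A + tlen B.
Proof.
move=> AB [T [t ht TE] hT].
have u0 : B - A != 0 by rewrite subr_eq0; apply/eqP => /esym.
have uu := ip_gt0 _ u0.
set u := B - A in u0 uu *.
pose d := T - center E.
have dd : ip d d = 1.
  by apply/ellipse_curveE; have [] : (line A B `&` ellipse_curve E) T by rewrite hT.
have AE : A - center E = d - t *: u.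
  by rewrite /d /u TE; apply: plane_eqP; rewrite !mxE; ring.
have BE : B - center E = d + (1 - t) *: u.
  by rewrite /d /u TE; apply: plane_eqP; rewrite !mxE; ring.
have du : ip d u = 0.
  (* [T + s *: u] is the second intersection of the line with the ellipse; tangency makes it equal
     to [T], so the radius is orthogonal to the side. *)
  pose s := -2 * ip d u / ip u u.
  have : (line A B `&` ellipse_curve E) (T + s *: u).
    split; first by exists (t + s); rewrite TE /u; apply: plane_eqP; rewrite !mxE; ring.
    apply/ellipse_curveE; rewrite addrAC -/d.
    have -> : ip (d + s *: u) (d + s *: u)
      = ip d d + s * (2 * ip d u + s * ip u u) by rewrite /ip !coordE; ring.
    by rewrite dd /s; field; rewrite gt_eqF.
  rewrite hT => /eqP; rewrite -subr_eq0 addrAC subrr add0r scaler_eq0.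
  rewrite (negbTE u0) orbF !mulf_eq0 invr_eq0 (gt_eqF uu) orbF.
  by case/orP=> /eqP // ?; lra.
set r := Num.sqrt (ip u u).
have rE : ip u u = r ^+ 2 by rewrite sqr_sqrtr // ip_ge0.
have r0 : 0 < r by rewrite sqrtr_gt0.
have h (s : R) : 0 <= s -> Num.sqrt (1 + s ^+ 2 * ip u u - 1) = s * r.
  move=> s0; rewrite rE.
  have -> : 1 + s ^+ 2 * r ^+ 2 - 1 = (s * r) ^+ 2 by ring.
  by rewrite sqrtr_sqr ger0_norm // mulr_ge0 // ltW.
have sq s : ip (d + s *: u) (d + s *: u) = 1 + s ^+ 2 * ip u u.
  by rewrite -dd -[RHS]addr0 -(mulr0 (2 * s)) -du /ip !coordE; ring.
have sum : tlen A + tlen B = r.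
  by rewrite /tlen AE BE -scaleNr !sq sqrrN !h; lra.
by rewrite sum.
Qed.

End EllipseForm.

(** * Convex quadrilaterals and their diagonals *)

Lemma line_inter_unique {R : realType} {A B C D P Q : plane R} :
  cross (B - A) (D - C) != 0 ->
  line A B P -> line C D P -> line A B Q -> line C D Q -> P = Q.
Proof.
move=> c0 P1 P2 Q1 Q2.
have [k hk] := line_dir Q1 P1; have [l hl] := line_dir Q2 P2.
have : k * cross (B - A) (D - C) = 0.
  by rewrite crossC mulrN -crossZr -hk hl crossZr cross_self mulr0 oppr0.
move/eqP; rewrite mulf_eq0 (negbTE c0) orbF => /eqP k0; apply/eqP.
by rewrite -subr_eq0 hk k0 scale0r.
Qed.

Lemma midpoint_line {R : realType} (A B : plane R) : line A B (midpoint A B).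
Proof. by exists 2^-1; apply: plane_eqP; rewrite !mxE; field. Qed.

(** Cyclic relabelling exchanges the diagonals, so that later arguments can treat [A C] alone. *)
Lemma convex_rot {R : realType} (A B C D : plane R) :
  convex_quadrilateral A B C D -> convex_quadrilateral B C D A.
Proof.
have cyc (X Y Z : plane R) : orient X Y Z = orient Y Z X.
  by rewrite !orientE /cross !mxE; ring.
by case=> h1 h2 h3 h4; split.
Qed.

Lemma midpointC {R : realType} (A B : plane R) : midpoint A B = midpoint B A.
Proof. by rewrite /midpoint addrC. Qed.

Lemma midpoint_diagonal_rot {R : realType} (A B C D : plane R) :
  midpoint_diagonal A B C D -> midpoint_diagonal B C D A.
Proof.
case=> P [hP hM]; exists P; rewrite setIC [segment C A]segmentC; split=> //.
by rewrite [midpoint C A]midpointC; case: hM; [right|left].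
Qed.

Section Convex.
Context {R : realType} {A B C D : plane R}.
Hypothesis hQ : convex_quadrilateral A B C D.

(** The determinant is the sum of the doubled signed areas of [A B C] and [C D A], and convexity
    gives both the sign of [orient B C D]. *)
Lemma convex_diag_cross : cross (C - A) (D - B) != 0.
Proof.
case: hQ => h1 h2 h3 h4.
have e : cross (C - A) (D - B) = orient A B C + orient C D A.
  by rewrite !orientE /cross !mxE; ring.
have c1 : orient B C A = orient A B C by rewrite !orientE /cross !mxE; ring.
have c2 : orient C D B = orient B C D by rewrite !orientE /cross !mxE; ring.
rewrite c1 in h2; rewrite c2 in h3; rewrite e; apply/eqP => e0.
have e1 : orient C D A = - orient A B C by lra.
rewrite e1 in h3.
have := mulr_gt0 h2 h3.
have -> : orient B C D * orient A B C * (- orient A B C * orient B C D)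
  = - (orient B C D * orient A B C) ^+ 2 by ring.
by rewrite oppr_gt0 ltNge sqr_ge0.
Qed.

Lemma convex_sides : [/\ A <> B, B <> C, C <> D & D <> A].
Proof.
have c0 (X Y : plane R) : orient X X Y = 0.
  by rewrite !orientE /cross !mxE; ring.
case: hQ => h1 h2 h3 h4; split=> e.
- by move: h1; rewrite e c0 mul0r ltxx.
- by move: h2; rewrite e c0 mul0r ltxx.
- by move: h3; rewrite e c0 mul0r ltxx.
- by move: h4; rewrite e c0 mul0r ltxx.
Qed.

Lemma convex_diag_neq : A <> C /\ B <> D.
Proof.
have := convex_diag_cross; split=> e; move: H; rewrite e subrr /cross !mxE.
  by rewrite !mul0r subrr eqxx.
by rewrite !mulr0 subrr eqxx.
Qed.

(** The intersection point divides [A C] in the ratio of the areas of [A B D] and [B C D], and [B D]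
    in the ratio of those of [A B C] and [C D A]. By convexity the four signed areas have one sign,
    so both parameters lie between 0 and 1. *)
Lemma convex_diag_inter : exists P, segment A C `&` segment B D = [set P].
Proof.
case: hQ => h1 h2 h3 h4; have c0 := convex_diag_cross.
set a := orient A B C in h1; set b := orient A B D in h1.
set c := orient B C D in h2; set d := orient C D A in h3.
have c1 : orient B C A = a by rewrite /a !orientE /cross !mxE; ring.
have c2 : orient C D B = c by rewrite /c !orientE /cross !mxE; ring.
have c3 : orient D A B = b by rewrite /b !orientE /cross !mxE; ring.
have c4 : orient D A C = d by rewrite /d !orientE /cross !mxE; ring.
rewrite c1 in h2; rewrite c2 in h3; rewrite c3 c4 in h4.
have bcE : b + c = a + d by rewrite /a /b /c /d !orientE /cross !mxE; ring.
(* Stated through the product so as to cover both orientations of the quadrilateral. *)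
have wt (x y : R) : 0 < x * y -> x + y != 0 /\ 0 <= x / (x + y) <= 1.
  move=> xy.
  have [x0|x0|x0] := ltgtP x 0.
  - have y0 : y < 0 by rewrite -(nmulr_rgt0 _ x0).
    split; first by lra.
    by rewrite -mulrNN -invrN divr_ge0 ?ler_pdivrMr; lra.
  - have y0 : 0 < y by rewrite -(pmulr_rgt0 _ x0).
    split; first by lra.
    by rewrite divr_ge0 ?ler_pdivrMr; lra.
  - by move: xy; rewrite x0 mul0r ltxx.
have bc : 0 < b * c.
  have : 0 < (a * b) * (c * a) by apply: mulr_gt0.
  have -> : a * b * (c * a) = a ^+ 2 * (b * c) by ring.
  by rewrite pmulr_rgt0 // exprn_even_gt0 //=; apply/eqP => a0; move: h1;
    rewrite a0 mul0r ltxx.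
have ad : 0 < a * d.
  have : 0 < (a * b) * (b * d) by apply: mulr_gt0.
  have -> : a * b * (b * d) = b ^+ 2 * (a * d) by ring.
  by rewrite pmulr_rgt0 // exprn_even_gt0 //=; apply/eqP => b0; move: h1;
    rewrite b0 mulr0 ltxx.
have [bc0 hb] := wt _ _ bc; have [ad0 ha] := wt _ _ ad.
pose P := (1 - b / (b + c)) *: A + (b / (b + c)) *: C.
have P1 : segment A C P by exists (b / (b + c)).
have P2 : segment B D P.
  exists (a / (a + d)) => //.
  have -> : d = b + c - a by lra.
  have -> : a + (b + c - a) = b + c by ring.
  have e : b + c = cross (C - A) (D - B).
    by rewrite /b /c !orientE /cross !mxE; ring.
  rewrite /P e; apply: plane_eqP; rewrite !mxE /a /b !orientE.
    move: c0; rewrite /cross !mxE => c0; field; exact: c0.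
  move: c0; rewrite /cross !mxE => c0; field; exact: c0.
exists P; apply/seteqP; split=> [X [X1 X2]|X ->] //=.
by apply: (line_inter_unique c0); apply: segment_line.
Qed.

(** The lines of the diagonals meet only once, so the midpoint is the point where the segments
    cross. *)
Lemma midpoint_AC : line B D (midpoint A C) -> midpoint_diagonal A B C D.
Proof.
move=> hM; have [P hP] := convex_diag_inter; exists P; split=> //; left.
have [P1 P2] : (segment A C `&` segment B D) P by rewrite hP.
exact: (line_inter_unique convex_diag_cross (segment_line _ P1) (segment_line _ P2)
  (midpoint_line A C) hM).
Qed.

End Convex.

(** * Quadrilaterals circumscribed about the ellipse *)

Section Tangential.
Context {R : realType} (E : ellipse R).

Definition circumscribed A B C D : Prop :=
  [/\ tangent_to_side E A B, tangent_to_side E B C,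
      tangent_to_side E C D & tangent_to_side E D A].

Lemma circumscribed_rot A B C D :
  circumscribed A B C D -> circumscribed B C D A.
Proof. by case. Qed.

Lemma midpoint_AC_orth A B C D :
  convex_quadrilateral A B C D -> circumscribed A B C D ->
  segment B D (midpoint A C) -> ip E (C - A) (D - B) = 0.
Proof.
move=> hQ [t1 t2 t3 t4] [t ht hM].
have [nAB nBC nCD nDA] := convex_sides hQ.
have [e1 p1] := tangent_side_length _ _ _ nAB t1.
have [e2 p2] := tangent_side_length _ _ _ nBC t2.
have [e3 p3] := tangent_side_length _ _ _ nCD t3.
have [e4 p4] := tangent_side_length _ _ _ nDA t4.
set a := tlen E A in e1 p1 e4 p4; set b := tlen E B in e1 p1 e2 p2.
set c := tlen E C in e2 p2 e3 p3; set d := tlen E D in e3 p3 e4 p4.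
set K := ip E (C - A) (D - B).
(* The midpoint condition solved for [C]; substituting it turns the next two relations into
   polynomial identities. *)
have CE : C = (2 * (1 - t)) *: B + (2 * t) *: D - A.
  move: hM => /(congr1 (fun u : plane R => (u 0 0, u 0 1))) [].
  by rewrite !mxE => h0 h1; apply: plane_eqP; rewrite !mxE; lra.
have f1 : (a - c) * (a + b + (b + c)) = - 2 * t * K.
  have -> : (a - c) * (a + b + (b + c)) = (a + b) ^+ 2 - (b + c) ^+ 2 by ring.
  by rewrite -e1 -e2 /K CE /ip !coordE; ring.
have f2 : (a - c) * (d + a + (c + d)) = 2 * (1 - t) * K.
  have -> : (a - c) * (d + a + (c + d)) = (d + a) ^+ 2 - (c + d) ^+ 2 by ring.
  by rewrite -e4 -e3 /K CE /ip !coordE; ring.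
(* The two differences of squared sides carry the sign of [a - c], but [K]
   enters them with opposite signs. *)
have ac : a - c = 0.
  apply/eqP; rewrite -sqrf_eq0 eq_le sqr_ge0 andbT.
  have pp : 0 < (a + b + (b + c)) * (d + a + (c + d)) by apply: mulr_gt0; lra.
  rewrite -(pmulr_lle0 _ pp).
  have -> : (a - c) ^+ 2 * ((a + b + (b + c)) * (d + a + (c + d))) =
    ((a - c) * (a + b + (b + c))) * ((a - c) * (d + a + (c + d))) by ring.
  rewrite f1 f2.
  have -> : -2 * t * K * (2 * (1 - t) * K) = - (4 * (t * (1 - t)) * K ^+ 2).
    by ring.
  by rewrite oppr_le0 mulr_ge0 ?sqr_ge0 // mulr_ge0 // mulr_ge0 //; lra.
(* Both right-hand sides now vanish, and their difference is [2 * K]. *)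
rewrite ac !mul0r in f1 f2; lra.
Qed.

(** Equal tangent lengths at [A] and [C] make [B] and [D] each equidistant from [A] and [C]. So
    [M - B] and [D - B] are both orthogonal to [A C], which puts [M] on the line [B D]. *)
Lemma eq_tlen_midpoint A B C D :
  convex_quadrilateral A B C D -> circumscribed A B C D ->
  tlen E A = tlen E C -> midpoint_diagonal A B C D.
Proof.
move=> hQ [t1 t2 t3 t4] ac.
have [nAB nBC nCD nDA] := convex_sides hQ.
have [nAC nBD] := convex_diag_neq hQ.
have [e1 _] := tangent_side_length _ _ _ nAB t1.
have [e2 _] := tangent_side_length _ _ _ nBC t2.
have [e3 _] := tangent_side_length _ _ _ nCD t3.
have [e4 _] := tangent_side_length _ _ _ nDA t4.
pose M := midpoint A C.
have AC0 : C - A != 0 by rewrite subr_eq0; apply/eqP => /esym.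
have BD0 : D - B != 0 by rewrite subr_eq0; apply/eqP => /esym.
have hB : ip E (M - B) (C - A) = 0.
  have -> : ip E (M - B) (C - A) = (ip E (C - B) (C - B) - ip E (B - A) (B - A)) / 2.
    by rewrite /M /midpoint /ip !coordE; field.
  by rewrite e1 e2 ac; field.
have hD : ip E (M - D) (C - A) = 0.
  have -> : ip E (M - D) (C - A) = (ip E (D - C) (D - C) - ip E (D - A) (D - A)) / 2.
    by rewrite /M /midpoint /ip !coordE; field.
  have -> : ip E (D - A) (D - A) = ip E (A - D) (A - D) by rewrite /ip !coordE; ring.
  by rewrite e3 e4 ac; field.
have hDB : ip E (D - B) (C - A) = 0.
  by rewrite -[RHS](subrr 0) -{1}hB -hD /ip !coordE; ring.
have [k hk] := cross_eq0P _ _ BD0 (ip_orth_cross _ _ _ _ AC0 hDB hB).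
apply: (midpoint_AC hQ); exists k.
rewrite -/M -[M](subrK B) hk; apply: plane_eqP; rewrite !mxE; ring.
Qed.

Lemma midpoint_diagonal_orth A B C D :
  convex_quadrilateral A B C D -> circumscribed A B C D ->
  midpoint_diagonal A B C D <-> ip E (C - A) (D - B) = 0.
Proof.
move=> hQ hT; split=> [[P [hP]]|K0].
  have [P1 P2] : (segment A C `&` segment B D) P by rewrite hP.
  case=> PE; first by apply: midpoint_AC_orth; rewrite // -PE.
  have : ip E (D - B) (A - C) = 0.
    apply: midpoint_AC_orth (convex_rot _ _ _ _ hQ) (circumscribed_rot _ _ _ _ hT) _.
    by rewrite -PE segmentC.
  by rewrite /ip !coordE => h; lra.
have [t1 t2 t3 t4] := hT.
have [nAB nBC nCD nDA] := convex_sides hQ.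
have [e1 _] := tangent_side_length _ _ _ nAB t1.
have [e2 _] := tangent_side_length _ _ _ nBC t2.
have [e3 _] := tangent_side_length _ _ _ nCD t3.
have [e4 _] := tangent_side_length _ _ _ nDA t4.
(* Perpendicular diagonals: opposite sides have equal sums of squares. *)
have : (tlen E A - tlen E C) * (tlen E B - tlen E D) = 0.
  have -> : (tlen E A - tlen E C) * (tlen E B - tlen E D) =
    ((tlen E A + tlen E B) ^+ 2 + (tlen E C + tlen E D) ^+ 2
     - (tlen E B + tlen E C) ^+ 2 - (tlen E D + tlen E A) ^+ 2) / 2 by field.
  by rewrite -e1 -e2 -e3 -e4 -[RHS]oppr0 -K0 /ip !coordE; field.
move/eqP; rewrite mulf_eq0 !subr_eq0 => /orP[/eqP ac|/eqP bd].
  exact: eq_tlen_midpoint.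
(* Three more rotations take [B C D A] back to [A B C D], so the previous case applies to the other
   diagonal. *)
do 3 apply: midpoint_diagonal_rot.
by apply: eq_tlen_midpoint bd; [exact: convex_rot|exact: circumscribed_rot].
Qed.

Lemma unit_vector (u : plane R) : u != 0 -> exists2 k, k != 0 & ip E (k *: u) (k *: u) = 1.
Proof.
move=> /ip_gt0 h; exists (Num.sqrt (ip E u u))^-1.
  by rewrite invr_eq0 gt_eqF // sqrtr_gt0.
rewrite ipZl ipC ipZl mulrA -invfM -expr2 sqr_sqrtr ?ltW // mulVf //.
by rewrite gt_eqF.
Qed.

End Tangential.

(** * Conjugate diameters along the diagonals *)

Theorem theorem4 (R : realType) (A B C D : plane R)
    (hQ : convex_quadrilateral A B C D) :
  (midpoint_diagonal A B C D ->
     forall E : ellipse R, inscribed E A B C D ->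
       exists! p : set (set (plane R)),
         conjugate_pair E p /\ pair_parallel_to_diagonals A B C D p) /\
  (~ midpoint_diagonal A B C D ->
     forall E : ellipse R, inscribed E A B C D ->
       ~ exists p : set (set (plane R)),
           conjugate_pair E p /\ pair_parallel_to_diagonals A B C D p).
Proof.
have [nAC nBD] := convex_diag_neq hQ.
have AC0 : C - A != 0 by rewrite subr_eq0; apply/eqP => /esym.
have BD0 : D - B != 0 by rewrite subr_eq0; apply/eqP => /esym.
have c0 := convex_diag_cross hQ.
(* Normal form of an admissible pair: orthogonal unit vectors along the two diagonals. It serves
   both the uniqueness in (i) and the impossibility in (ii). *)
have key E p : conjugate_pair E p -> pair_parallel_to_diagonals A B C D p ->
  exists x y, [/\ ip E x x = 1, ip E y y = 1, cross x (C - A) = 0,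
    cross y (D - B) = 0 & ip E x y = 0 /\ p = [set diam E x; diam E y]].
  move=> [l' [m' [pE cj]]] [l [m [pE' pl pm]]].
  have [/diamP [x' x1 lE] /diamP [y' y1 mE] _] := cj.
  have xy : ip E x' y' = 0 by apply/conjugate_diam; rewrite // -lE -mE.
  have x0 := ip_unit_neq0 _ _ x1; have y0 := ip_unit_neq0 _ _ y1.
  have hl : p l by rewrite pE'; left.
  have hm : p m by rewrite pE'; right.
  (* The two descriptions of the unordered pair may list it in either order; one diameter cannot
     play both roles, because the diagonals are not parallel. *)
  have hlm z : ip E z z = 1 -> l = diam E z -> m = diam E z -> False.
    move=> /ip_unit_neq0 z0 hl' hm'; move: pl pm; rewrite hl' hm'.
    move=> /(diam_parallel _ _ _ _ z0 nAC) /(cross_eq0P _ _ z0) [k hk].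
    move=> /(diam_parallel _ _ _ _ z0 nBD) h.
    by move: c0; rewrite hk crossC crossZr crossC h oppr0 mulr0 oppr0 eqxx.
  move: (hl) (hm); rewrite {1 2}pE lE mE => -[hl'|hl'] [hm'|hm'].
  - by case: (hlm x').
  - exists x', y'; split=> //; last by rewrite pE' hl' hm'.
    + by move: pl; rewrite hl' => /(diam_parallel _ _ _ _ x0 nAC).
    + by move: pm; rewrite hm' => /(diam_parallel _ _ _ _ y0 nBD).
  - exists y', x'; split=> //; last by rewrite pE' hl' hm' ipC.
    + by move: pl; rewrite hl' => /(diam_parallel _ _ _ _ y0 nAC).
    + by move: pm; rewrite hm' => /(diam_parallel _ _ _ _ x0 nBD).
  - by case: (hlm y').
split=> [hM E [_ hT]|nM E [_ hT] [p [cp pp]]]; last first.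
  have [x [y [x1 y1 cx cy [xy _]]]] := key E p cp pp.
  apply: nM; apply/(midpoint_diagonal_orth _ _ _ _ _ hQ hT).
  have [k ->] := cross_eq0P _ _ (ip_unit_neq0 _ _ x1) cx.
  have [l ->] := cross_eq0P _ _ (ip_unit_neq0 _ _ y1) cy.
  by rewrite ipZl ipC ipZl ipC xy !mulr0.
have K0 := (midpoint_diagonal_orth _ _ _ _ _ hQ hT).1 hM.
(* Existence: the diagonals, scaled to unit vectors, are themselves the required radius vectors. *)
have [k k0 x1] := unit_vector E _ AC0; have [l l0 y1] := unit_vector E _ BD0.
set x := k *: (C - A) in x1; set y := l *: (D - B) in y1.
exists [set diam E x; diam E y]; split.
  split; exists (diam E x), (diam E y); split=> //.
  - by apply/conjugate_diam => //; rewrite ipZl ipC ipZl ipC K0 !mulr0.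
  - apply/(diam_parallel _ _ _ _ (ip_unit_neq0 _ _ x1) nAC).
    by rewrite crossC crossZr cross_self mulr0 oppr0.
  - apply/(diam_parallel _ _ _ _ (ip_unit_neq0 _ _ y1) nBD).
    by rewrite crossC crossZr cross_self mulr0 oppr0.
move=> p [cp pp]; have [x' [y' [x1' y1' cx cy [_ ->]]]] := key E p cp pp.
rewrite (unit_collinear E x' x) ?(unit_collinear E y' y) //.
  by rewrite crossZr cy mulr0.
by rewrite crossZr cx mulr0.
Qed.
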